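(* Let $q\in\mathbb{R}$ and $p_1,p_2\in\mathbb{R}$ be such that for each $i=1,2$ either $p_i\le0$ or $0<p_i\le 3q$. Consider the double inequality \[ \left(1-\frac{p_1}{3q}+\frac{p_1}{3q}\cos^q x\right)^{1/p_1}<\frac{\sin x}{x}<\left(1-\frac{p_2}{3q}+\frac{p_2}{3q}\cos^q x\right)^{1/p_2}\qquad (x\in(0,\pi/2)). \tag{$*$} \] (i) If $q\ge1$, then $( * )$ holds for all $x\in(0,\pi/2)$ if and only if $p_1\ge p(q)$ and $p_2\le 3q-\frac85$. (ii) If $0<q\le\frac{34}{35}$, then $( * )$ holds for all $x\in(0,\pi/2)$ if and only if $p_1\ge 3q-\frac85$ and $p_2\le p(q)$. (iii) If $q\le0$, then the first inequality in $( * )$ holds for all $x\in(0,\pi/2)$ if and only if $p_1\ge 3q-\frac85$.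
   Context: The expressions in $( * )$ are interpreted by limits when $p_i=0$ or $q=0$: $\left(1-\frac{p}{3q}+\frac{p}{3q}t^q\right)^{1/p}$ means $\exp\frac{t^q-1}{3q}$ if $p=0\ne q$, $\left(1+\frac p3\ln t\right)^{1/p}$ if $q=0\ne p$, and $t^{1/3}$ if $p=q=0$. For $q>0$, $p(q)$ denotes the unique real $p$ with $\frac{q}{p}\left(1-\left(\frac2\pi\right)^p\right)=\frac13$ (for $p=0$ the left side means $q\ln\frac\pi2$); equivalently $p(q)$ is the inverse function of $q(p)=\frac{p}{3(1-(2/\pi)^p)}$ ($q(0)=\frac{1}{3\ln(\pi/2)}$). *)

(* Defs.v *)
From Stdlib Require Import Reals.
Open Scope R_scope.

(* The mean  (1 - p/(3q) + p/(3q) t^q)^(1/p), with the limiting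
   interpretations when p = 0 and/or q = 0 (t = cos x in (0,1)). *)
Definition Mpq (p q t : R) : R :=
  if Req_EM_T p 0 then
    (if Req_EM_T q 0 then Rpower t (1/3)
     else exp ((Rpower t q - 1) / (3 * q)))
  else if Req_EM_T q 0 then Rpower (1 + p / 3 * ln t) (1 / p)
  else Rpower (1 - p / (3 * q) + p / (3 * q) * Rpower t q) (1 / p).

(* q(p) = p / (3 (1 - (2/pi)^p)), q(0) = 1/(3 ln(pi/2));
   p(q) is its inverse function. *)
Definition qfun (p : R) : R :=
  if Req_EM_T p 0 then 1 / (3 * ln (PI / 2))
  else p / (3 * (1 - Rpower (2 / PI) p)).

Definition admissible (p q : R) : Prop := p <= 0 \/ (0 < p /\ p <= 3 * q).

(* Main.v *)
(* With s = sin x and c = cos x, put P_p(y) = (1 - y^p)/p (that is, -ln y for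
   p = 0). Comparing the mean with s/x amounts to the sign of
   D = P_p(s/x) - P_q(c)/3. One has D' = g (e^L - 1) and L' = k h with g, k > 0,
   where D and L vanish at 0+ and
     h = (q - 1) U + W - p,   U = x s^2/(c A),
     W = (x^2 (s^2 + 2 c^2) - s^2 - x s c)/A^2,   A = s - x c.
   Here U(0+) = 3 and W(0+) = 7/5, so h(0+) = 3q - 8/5 - p. The heart is
   0 < 35 W' < U', which makes h increasing for q >= 1 and decreasing for
   q <= 34/35. Hence either h has constant sign, and so has D, or h changes sign
   once, and then D is controlled by its limits at 0 and pi/2, the latter being
   P_p(2/pi) - 1/(3q), which vanishes exactly for p = p(q). The trigonometric
   inequalities behind 0 < 35 W' < U' are rewritten in the sines and cosines of x,
   3x and 5x and follow from Taylor bounds. *)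
Require Import Defs.
From Stdlib Require Import Reals Factorial Lra Lia Classical.
From Coquelicot Require Import Coquelicot.
Open Scope R_scope.

(** * Monotonicity from derivatives, and Taylor bounds for sine and cosine *)

Lemma increasing_on_closed (f df : R -> R) (a b : R) :
  a < b ->
  (forall x, a <= x <= b -> is_derive f x (df x)) ->
  (forall x, a < x < b -> 0 < df x) -> f a < f b.
Proof.
intros Hab Hd Hp.
destruct (MVT_cor2 f df a b Hab) as [c [E Hc]].
- intros c Hc; apply is_derive_Reals, Hd, Hc.
- specialize (Hp c Hc).
  assert (0 < df c * (b - a)) by (apply Rmult_lt_0_compat; lra); lra.
Qed.

Lemma nondecreasing_from_0 (f df : R -> R) :
  f 0 = 0 ->
  (forall x, is_derive f x (df x)) ->
  (forall x, 0 <= x -> 0 <= df x) -> forall x, 0 <= x -> 0 <= f x.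
Proof.
intros H0 Hd Hp x [Hx | <-]; [ | lra].
destruct (MVT_cor2 f df 0 x Hx) as [c [E Hc]].
- intros c _; apply is_derive_Reals, Hd.
- assert (Hc' : 0 <= df c) by (apply Hp; lra).
  assert (0 <= df c * (x - 0)) by (apply Rmult_le_pos; lra); lra.
Qed.

Lemma is_derive_monomial (a b : R) (n : nat) (x : R) :
  is_derive (fun y => a * (y ^ S n / b)) x (a * (INR (S n) * x ^ n / b)).
Proof. auto_derive; [easy | ].
change (a * (1 * (INR (S n) * x ^ n) * / b) = a * (INR (S n) * x ^ n / b)).
unfold Rdiv; ring. Qed.

Lemma is_derive_sin_approx (n : nat) (x : R) :
  is_derive (fun y => sin_approx y n) x (cos_approx x n).
Proof.
unfold sin_approx, cos_approx; induction n as [ | n IH].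
- unfold sin_term, cos_term; simpl; auto_derive; [easy | field].
- simpl sum_f_R0; refine (is_derive_plus _ _ _ _ _ IH _).
  unfold sin_term, cos_term.
  replace (2 * S n + 1)%nat with (S (2 * S n)) by lia.
  rewrite fact_simpl, mult_INR.
  evar_last; [apply is_derive_monomial | ].
  field; split; [apply INR_fact_neq_0 | apply not_0_INR; lia].
Qed.

Lemma is_derive_cos_approx (n : nat) (x : R) :
  is_derive (fun y => cos_approx y (S n)) x (- sin_approx x n).
Proof.
unfold sin_approx, cos_approx; induction n as [ | n IH].
- unfold sin_term, cos_term; simpl; auto_derive; [easy | field].
- change (is_derive (fun y => sum_f_R0 (cos_term y) (S n) + cos_term y (S (S n))) x
    (- (sum_f_R0 (sin_term x) n + sin_term x (S n)))).
  rewrite Ropp_plus_distr.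
  refine (is_derive_plus _ _ _ _ _ IH _).
  unfold sin_term, cos_term.
  replace (2 * S (S n))%nat with (S (2 * S n + 1)) by lia.
  rewrite fact_simpl, mult_INR.
  evar_last; [apply is_derive_monomial | ].
  rewrite <- (tech_pow_Rmult (-1) (S n)).
  field; split; [apply INR_fact_neq_0 | apply not_0_INR; lia].
Qed.

Lemma sin_approx_0 (n : nat) : sin_approx 0 n = 0.
Proof.
unfold sin_approx; induction n as [ | n IH].
- unfold sin_term; simpl; field.
- simpl sum_f_R0; rewrite IH; unfold sin_term.
  rewrite pow_ne_zero by lia; unfold Rdiv; ring.
Qed.

Lemma cos_approx_0 (n : nat) : cos_approx 0 n = 1.
Proof.
unfold cos_approx; induction n as [ | n IH].
- unfold cos_term; simpl; field.
- simpl sum_f_R0; rewrite IH; unfold cos_term.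
  rewrite (pow_ne_zero (2 * S n)) by lia; unfold Rdiv; ring.
Qed.

(** The sine remainder of order n has the cosine remainder of order n as derivative, and the cosine
    remainder of order n + 1 has minus the sine remainder of order n. All of them vanish at 0, so
    the sign passes up by integration, starting from cos x <= 1. No upper limit on x arises, which
    allows the bounds to be used at 3x and 5x. *)
Lemma sin_cos_approx_remainder (n : nat) (x : R) : 0 <= x ->
  0 <= (-1) ^ n * (cos_approx x n - cos x) /\
  0 <= (-1) ^ n * (sin_approx x n - sin x).
Proof.
revert x.
assert (Hsin : forall m,
  (forall x, 0 <= x -> 0 <= (-1) ^ m * (cos_approx x m - cos x)) ->
  forall x, 0 <= x -> 0 <= (-1) ^ m * (sin_approx x m - sin x)).
{ intros m Hm.
  apply nondecreasing_from_0 with (2 := fun x => is_derive_scal _ _ ((-1) ^ m) _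
    (is_derive_minus _ _ _ _ _ (is_derive_sin_approx m x) (is_derive_sin x))).
  - change ((-1) ^ m * (sin_approx 0 m - sin 0) = 0).
    rewrite sin_approx_0, sin_0; ring.
  - intros x Hx; exact (Hm x Hx). }
induction n as [ | n IH].
- assert (Hc : forall x, 0 <= x -> 0 <= (-1) ^ 0 * (cos_approx x 0 - cos x)).
  { intros x _; unfold cos_approx, cos_term; simpl.
    pose proof (COS_bound x); lra. }
  intros x Hx; split; [now apply Hc | now apply (Hsin 0%nat)].
- assert (Hc : forall x, 0 <= x -> 0 <= (-1) ^ S n * (cos_approx x (S n) - cos x)).
  { apply nondecreasing_from_0 with (2 := fun x => is_derive_scal _ _ ((-1) ^ S n) _
      (is_derive_minus _ _ _ _ _ (is_derive_cos_approx n x) (is_derive_cos x))).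
    - change ((-1) ^ S n * (cos_approx 0 (S n) - cos 0) = 0).
      rewrite cos_approx_0, cos_0; ring.
    - intros x Hx; destruct (IH x Hx) as [_ Hs].
      change (0 <= (-1) ^ S n * (- sin_approx x n + - - sin x)).
      rewrite <- tech_pow_Rmult; lra. }
  intros x Hx; split; [now apply Hc | now apply (Hsin (S n))].
Qed.

Lemma sin_approx_bounds (n : nat) (x : R) : 0 <= x ->
  sin_approx x (2 * n + 1) <= sin x <= sin_approx x (2 * n).
Proof.
intros Hx.
pose proof (proj2 (sin_cos_approx_remainder (2 * n) x Hx)) as H1.
pose proof (proj2 (sin_cos_approx_remainder (2 * n + 1) x Hx)) as H2.
rewrite pow_1_even in H1; replace (2 * n + 1)%nat with (S (2 * n)) in * by lia.
rewrite pow_1_odd in H2; lra.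
Qed.

Lemma cos_approx_bounds (n : nat) (x : R) : 0 <= x ->
  cos_approx x (2 * n + 1) <= cos x <= cos_approx x (2 * n).
Proof.
intros Hx.
pose proof (proj1 (sin_cos_approx_remainder (2 * n) x Hx)) as H1.
pose proof (proj1 (sin_cos_approx_remainder (2 * n + 1) x Hx)) as H2.
rewrite pow_1_even in H1; replace (2 * n + 1)%nat with (S (2 * n)) in * by lia.
rewrite pow_1_odd in H2; lra.
Qed.

(** Binary factorials: the Taylor sums below reach 22!, too large for unary evaluation. *)
Fixpoint factZ (n : nat) : Z :=
  match n with O => 1%Z | S m => (Z.of_nat (S m) * factZ m)%Z end.

Lemma INR_fact (n : nat) : INR (fact n) = IZR (factZ n).
Proof.
induction n as [ | n IH]; [easy | ].
rewrite fact_simpl, mult_INR, IH, INR_IZR_INZ, <- mult_IZR; easy.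
Qed.

(* Turns the Taylor sums in [H] into explicit polynomials; [fact] is evaluated in [Z]. *)
Ltac expand_approx H :=
  unfold sin_approx, cos_approx, sin_term, cos_term in H;
  cbn [sum_f_R0 Nat.mul Nat.add] in H;
  repeat rewrite INR_fact in H;
  repeat match type of H with
  | context [factZ ?n] => let v := eval vm_compute in (factZ n) in
      change (factZ n) with v in H
  end.

(** * Trigonometric inequalities on (0, 1.6), a rational enlargement of (0, pi/2) *)

Lemma PI2_lt_1_6 : PI / 2 < 16 / 10.
Proof.
apply Rnot_le_lt; intros H.
(* The Taylor polynomial of degree 4, an upper bound of cos, is already negative at 1.6. *)
pose proof (proj2 (cos_approx_bounds 1 (16 / 10) ltac:(lra))) as Hc.
expand_approx Hc.
assert (0 <= cos (16 / 10)).
{ apply cos_ge_0; lra. }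
lra.
Qed.

Lemma sin_sqr (x : R) : sin x ^ 2 = 1 - cos x ^ 2.
Proof. generalize (sin2_cos2 x); unfold Rsqr; lra. Qed.

Lemma cos_3x (x : R) : cos (3 * x) = cos x ^ 3 - 3 * cos x * sin x ^ 2.
Proof.
replace (3 * x) with (2 * x + x) by ring.
rewrite cos_plus, sin_2a, cos_2a; ring.
Qed.

Lemma sin_3x (x : R) : sin (3 * x) = 3 * sin x * cos x ^ 2 - sin x ^ 3.
Proof.
replace (3 * x) with (2 * x + x) by ring.
rewrite sin_plus, sin_2a, cos_2a; ring.
Qed.

Lemma cos_5x (x : R) :
  cos (5 * x) = cos x ^ 5 - 10 * cos x ^ 3 * sin x ^ 2 + 5 * cos x * sin x ^ 4.
Proof.
replace (5 * x) with (3 * x + 2 * x) by ring.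
rewrite cos_plus, cos_3x, sin_3x, sin_2a, cos_2a; ring.
Qed.

Lemma sin_5x (x : R) :
  sin (5 * x) = 5 * sin x * cos x ^ 4 - 10 * sin x ^ 3 * cos x ^ 2 + sin x ^ 5.
Proof.
replace (5 * x) with (3 * x + 2 * x) by ring.
rewrite sin_plus, cos_3x, sin_3x, sin_2a, cos_2a; ring.
Qed.

(* Numerators: [-(sin x / x)' = Afun x / x^2], [Ufun' = sin x * Bfun x / (cos x * Afun x)^2]
   and [Wfun' = Efun x / Afun x^3]. *)
Definition Afun (x : R) : R := sin x - x * cos x.
Definition Efun (x : R) : R :=
  x * sin x * (5 + cos x ^ 2) - 3 * cos x * (sin x ^ 2 + x ^ 2) - 2 * x ^ 3 * sin x.
Definition Bfun (x : R) : R :=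
  sin x ^ 2 * cos x + x * sin x - 2 * x ^ 2 * cos x.

(** Products of sines and cosines are made linear, so that each term can be replaced by a one-sided
    Taylor bound. *)
Lemma Efun_multiples (x : R) : 4 * Efun x =
  21 * (x * sin x) + x * sin (3 * x) - 3 * cos x + 3 * cos (3 * x)
  - 12 * (x ^ 2 * cos x) - 8 * (x ^ 3 * sin x).
Proof.
rewrite cos_3x, sin_3x; unfold Efun.
replace (sin x ^ 3) with (sin x * sin x ^ 2) by ring.
rewrite !sin_sqr; ring.
Qed.

Lemma sin_A_B_minus_35_cos2_E_multiples (x : R) :
  16 * (sin x * Afun x * Bfun x - 35 * cos x ^ 2 * Efun x) =
  212 * cos x - 108 * cos (3 * x) - 104 * cos (5 * x)
  - x * (760 * sin x + 810 * sin (3 * x) + 34 * sin (5 * x))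
  + x ^ 2 * (1248 * cos x + 432 * cos (3 * x))
  + 288 * x ^ 3 * (sin x + sin (3 * x)).
Proof.
rewrite cos_3x, sin_3x, cos_5x, sin_5x; unfold Efun, Afun, Bfun.
assert (H4 : sin x ^ 4 = (1 - cos x ^ 2) ^ 2) by (rewrite <- sin_sqr; ring).
assert (H3 : sin x ^ 3 = sin x * (1 - cos x ^ 2)) by (rewrite <- sin_sqr; ring).
assert (H5 : sin x ^ 5 = sin x * (1 - cos x ^ 2) ^ 2) by (rewrite <- sin_sqr; ring).
pose proof (sin_sqr x) as H2.
ring_simplify.
rewrite ?H5, ?H4, ?H3, ?H2; ring.
Qed.

Lemma Efun_pos (x : R) : 0 < x < 16 / 10 -> 0 < Efun x.
Proof.
intros Hx.
(* Lower or upper bounds are taken according to the signs of the coefficients in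
   [Efun_multiples]. *)
pose proof (proj1 (sin_approx_bounds 2 x ltac:(lra))) as H1.
pose proof (proj1 (sin_approx_bounds 2 (3 * x) ltac:(lra))) as H2.
pose proof (proj2 (cos_approx_bounds 3 x ltac:(lra))) as H3.
pose proof (proj1 (cos_approx_bounds 3 (3 * x) ltac:(lra))) as H4.
pose proof (proj2 (sin_approx_bounds 2 x ltac:(lra))) as H5.
expand_approx H1; expand_approx H2; expand_approx H3; expand_approx H4; expand_approx H5.
apply (Rmult_le_compat_l x) in H1, H2; [ | lra | lra].
assert (Hx2 : 0 < x ^ 2 < 256 / 100) by nra.
assert (Hx3 : 0 < x ^ 3) by (apply pow_lt; lra).
pose proof (Rmult_le_compat_l _ _ _ (Rlt_le _ _ (proj1 Hx2)) H3) as H6.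
apply (Rmult_le_compat_l (x ^ 3)) in H5; [ | lra].
(* This is the collected Taylor lower bound of [4 * Efun x]: all terms below x^10 cancel, and the
   bracket stays positive up to x^2 = 2.56. *)
assert (Hp : 0 < x ^ 10 * (32 / 4725 - 16 / 14175 * x ^ 2
                           - 4783697 / 29059430400 * (x ^ 2) ^ 2)).
{ apply Rmult_lt_0_compat; [apply pow_lt; lra | nra]. }
pose proof (Efun_multiples x); lra.
Qed.

(** Up to a positive factor this is U' - 35 W'. Near 0 both terms of the difference are 8/135 x^10
    to leading order, so 35 is the best constant and the difference only starts at x^12. This is the
    origin of the threshold 34/35 = 1 - 1/35. *)
Lemma sin_A_B_minus_35_cos2_E_pos (x : R) : 0 < x < 16 / 10 ->
  0 < sin x * Afun x * Bfun x - 35 * cos x ^ 2 * Efun x.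
Proof.
intros Hx.
assert (Hx2 : 0 < x ^ 2 < 256 / 100) by nra.
assert (Hx3 : 0 < x ^ 3) by (apply pow_lt; lra).
pose proof (proj1 (cos_approx_bounds 5 x ltac:(lra))) as H1.
pose proof (proj2 (cos_approx_bounds 5 (3 * x) ltac:(lra))) as H2.
pose proof (proj2 (cos_approx_bounds 5 (5 * x) ltac:(lra))) as H3.
pose proof (proj2 (sin_approx_bounds 5 x ltac:(lra))) as H4.
pose proof (proj2 (sin_approx_bounds 5 (3 * x) ltac:(lra))) as H5.
pose proof (proj2 (sin_approx_bounds 5 (5 * x) ltac:(lra))) as H6.
pose proof (proj1 (cos_approx_bounds 4 x ltac:(lra))) as H7.
pose proof (proj1 (cos_approx_bounds 4 (3 * x) ltac:(lra))) as H8.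
pose proof (proj1 (sin_approx_bounds 4 x ltac:(lra))) as H9.
pose proof (proj1 (sin_approx_bounds 4 (3 * x) ltac:(lra))) as H10.
expand_approx H1; expand_approx H2; expand_approx H3; expand_approx H4; expand_approx H5.
expand_approx H6; expand_approx H7; expand_approx H8; expand_approx H9; expand_approx H10.
apply (Rmult_le_compat_l x) in H4, H5, H6; [ | lra | lra | lra].
apply (Rmult_le_compat_l (x ^ 2)) in H7, H8; [ | lra | lra].
apply (Rmult_le_compat_l (x ^ 3)) in H9, H10; [ | lra | lra].
(* The collected Taylor lower bound of 16 times the claim, split into a cubic in x^2 and a tail that
   is positive by itself. *)
assert (Hp : 0 < x ^ 12 * (1024 / 1575 - 6656 / 17325 * x ^ 2
  + 738688 / 7882875 * (x ^ 2) ^ 2 - 2878016 / 212837625 * (x ^ 2) ^ 3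
  + (x ^ 2) ^ 4 * (24249032 / 18091198125
    - 89988378766939013 / 281000181944401920000 * x ^ 2))).
{ apply Rmult_lt_0_compat; [apply pow_lt; lra | ].
  apply Rplus_lt_le_0_compat.
  - (* The second factor bounds, up to sign, the quotient of the cubic in [x ^ 2] by [x ^ 2 - 256 / 100]. *)
    assert (0 <= (256 / 100 - x ^ 2)
        * (233 / 1000 - 5905 / 100000 * x ^ 2 + 13523 / 1000000 * (x ^ 2) ^ 2)).
    { apply Rmult_le_pos; [lra | ].
      pose proof (pow2_ge_0 (x ^ 2 - 2)); lra. }
    assert (0 <= (x ^ 2) ^ 2) by apply pow2_ge_0.
    assert (0 <= (x ^ 2) ^ 3) by (apply pow_le; lra).
    lra.
  - apply Rmult_le_pos; [apply pow_le; lra | lra]. }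
pose proof (sin_A_B_minus_35_cos2_E_multiples x); lra.
Qed.

(** * Derivatives and monotonicity of U, W and h *)

Lemma sin_cos_pos (x : R) : 0 < x < PI / 2 -> 0 < sin x /\ 0 < cos x.
Proof.
intros Hx; split; [apply sin_gt_0 | apply cos_gt_0]; lra.
Qed.

Lemma is_derive_Afun (x : R) : is_derive Afun x (x * sin x).
Proof. unfold Afun; auto_derive; [easy | ring]. Qed.

Lemma Afun_pos (x : R) : 0 < x < PI / 2 -> 0 < Afun x.
Proof.
intros Hx.
replace 0 with (Afun 0) by (unfold Afun; rewrite sin_0; ring).
apply increasing_on_closed with (df := fun y => y * sin y); [lra | | ].
- intros y _; apply is_derive_Afun.
- intros y Hy; apply Rmult_lt_0_compat; [lra | apply sin_cos_pos; lra].
Qed.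

(** Read off from sin x A B > 35 cos^2 x E > 0, where sin x and A are positive. *)
Lemma Bfun_pos (x : R) : 0 < x < PI / 2 -> 0 < Bfun x.
Proof.
intros Hx; pose proof PI2_lt_1_6.
destruct (sin_cos_pos x Hx) as [Hs Hc]; pose proof (Afun_pos x Hx) as HA.
assert (HE : 0 < Efun x) by (apply Efun_pos; lra).
assert (HF := sin_A_B_minus_35_cos2_E_pos x ltac:(lra)).
assert (0 < cos x ^ 2 * Efun x) by (apply Rmult_lt_0_compat; [apply pow_lt | ]; easy).
apply Rmult_lt_reg_l with (sin x * Afun x); [now apply Rmult_lt_0_compat | lra].
Qed.

(** Dividing L' by k = A/(x sin x) leaves -p, the coefficient [Ufun] of q - 1 and the remainder
    [Wfun]. Thus p only shifts h, and the monotonicity of h depends on q alone. *)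
Definition Ufun (x : R) : R := x * sin x ^ 2 / (cos x * Afun x).
Definition Nfun (x : R) : R :=
  x ^ 2 * (sin x ^ 2 + 2 * cos x ^ 2) - sin x ^ 2 - x * sin x * cos x.
Definition Wfun (x : R) : R := Nfun x / Afun x ^ 2.
Definition hfun (p q x : R) : R := (q - 1) * Ufun x + Wfun x - p.






Lemma is_derive_Ufun (x : R) : 0 < x < PI / 2 ->
  is_derive Ufun x (sin x * Bfun x / (cos x * Afun x) ^ 2).
Proof.
intros Hx; pose proof (Afun_pos x Hx) as HA; destruct (sin_cos_pos x Hx) as [Hs Hc].
unfold Ufun, Afun in *; auto_derive.
- apply Rmult_integral_contrapositive; lra.
- unfold Bfun.
  (* The numerator from the quotient rule, divided by sin x. *)
  replace (sin x ^ 2 * cos x + x * sin x - 2 * x ^ 2 * cos x) with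
    ((sin x - x * cos x) * (sin x * cos x + 2 * x * cos x ^ 2 + x * sin x ^ 2)
       - x ^ 2 * sin x ^ 2 * cos x) by (ring_simplify;
         replace (sin x ^ 3) with (sin x * sin x ^ 2) by ring; rewrite !sin_sqr; ring).
  field; lra.
Qed.

Lemma is_derive_Wfun (x : R) : 0 < x < PI / 2 ->
  is_derive Wfun x (Efun x / Afun x ^ 3).
Proof.
intros Hx; pose proof (Afun_pos x Hx) as HA.
unfold Wfun, Nfun, Afun in *; auto_derive.
- apply (pow_nonzero _ 2); lra.
- replace (Efun x) with
   ((2 * x * (sin x ^ 2 + 2 * cos x ^ 2) - 2 * x ^ 2 * sin x * cos x
      - 3 * sin x * cos x - x * (cos x ^ 2 - sin x ^ 2)) * (sin x - x * cos x)
    - 2 * x * sin x * (x ^ 2 * (sin x ^ 2 + 2 * cos x ^ 2)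
         - sin x ^ 2 - x * sin x * cos x)).
  + field; lra.
  + unfold Efun; pose proof (sin_sqr x) as H2.
    assert (H3 : sin x ^ 3 = sin x * (1 - cos x ^ 2)) by (rewrite <- sin_sqr; ring).
    ring_simplify; rewrite ?H3, ?H2; ring.
Qed.

Lemma is_derive_hfun (p q x : R) : 0 < x < PI / 2 ->
  is_derive (hfun p q) x ((q - 1) * (sin x * Bfun x / (cos x * Afun x) ^ 2)
                            + Efun x / Afun x ^ 3).
Proof.
intros Hx; unfold hfun.
pose proof (is_derive_scal _ _ (q - 1) _ (is_derive_Ufun x Hx)) as HU.
pose proof (is_derive_plus _ _ _ _ _ HU (is_derive_Wfun x Hx)) as HUW.
evar_last; [exact (is_derive_minus _ _ _ _ _ HUW (is_derive_const p x)) | ].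
unfold minus, plus, opp, zero; simpl; ring.
Qed.

Lemma hfun_increasing (p q x y : R) : 1 <= q ->
  0 < x -> x < y -> y < PI / 2 -> hfun p q x < hfun p q y.
Proof.
intros Hq Hx Hxy Hy; pose proof PI2_lt_1_6.
apply (increasing_on_closed (hfun p q) _ x y Hxy
  (fun z Hz => is_derive_hfun p q z ltac:(lra))).
intros z Hz; assert (Hz' : 0 < z < PI / 2) by lra.
destruct (sin_cos_pos z Hz') as [Hs Hc]; pose proof (Afun_pos z Hz') as HA.
pose proof (Bfun_pos z Hz').
apply Rplus_le_lt_0_compat.
- apply Rmult_le_pos; [lra | ].
  apply Rlt_le, Rdiv_lt_0_compat; [now apply Rmult_lt_0_compat | ].
  now apply pow_lt, Rmult_lt_0_compat.
- apply Rdiv_lt_0_compat; [apply Efun_pos; lra | now apply pow_lt].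
Qed.

Lemma hfun_decreasing (p q x y : R) : q <= 34 / 35 ->
  0 < x -> x < y -> y < PI / 2 -> hfun p q y < hfun p q x.
Proof.
intros Hq Hx Hxy Hy; pose proof PI2_lt_1_6.
apply Ropp_lt_cancel.
apply (increasing_on_closed (fun z => - hfun p q z) _ x y Hxy
  (fun z Hz => is_derive_opp _ _ _ (is_derive_hfun p q z ltac:(lra)))).
intros z Hz; assert (Hz' : 0 < z < PI / 2) by lra.
destruct (sin_cos_pos z Hz') as [Hs Hc]; pose proof (Afun_pos z Hz') as HA.
pose proof (Bfun_pos z Hz') as HB.
pose proof (sin_A_B_minus_35_cos2_E_pos z ltac:(lra)) as HF.
assert (HU : 0 < sin z * Bfun z / (cos z * Afun z) ^ 2).
{ apply Rdiv_lt_0_compat; [now apply Rmult_lt_0_compat | ].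
  now apply pow_lt, Rmult_lt_0_compat. }
assert (HW : 35 * (Efun z / Afun z ^ 3) < sin z * Bfun z / (cos z * Afun z) ^ 2).
{ apply Rlt_0_minus.
  replace (_ - _) with ((sin z * Afun z * Bfun z - 35 * cos z ^ 2 * Efun z)
     / (cos z ^ 2 * Afun z ^ 3)) by (field; lra).
  apply Rdiv_lt_0_compat; [easy | ].
  apply Rmult_lt_0_compat; now apply pow_lt. }
apply Ropp_0_gt_lt_contravar.
(* Since q - 1 <= -1/35 and U' > 0, (q - 1) U' + W' <= W' - U'/35 < 0. *)
nra.
Qed.

(** * Limits at 0 of U, W, h and L *)

Lemma at_right_0_intro (P : R -> Prop) (d : R) :
  0 < d -> (forall x, 0 < x < d -> P x) -> at_right 0 P.
Proof.
intros Hd H; exists (mkposreal d Hd); intros y Hy Hy0; apply H; split; [easy | ].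
apply Rabs_lt_between in Hy; unfold minus, plus, opp in Hy; simpl in Hy; lra.
Qed.

Lemma at_right_0_elim (P : R -> Prop) :
  at_right 0 P -> exists d, 0 < d /\ forall x, 0 < x < d -> P x.
Proof.
intros [d H]; exists d; split; [apply cond_pos | ].
intros x Hx; apply H; [ | easy].
apply Rabs_lt_between; unfold minus, plus, opp; simpl; lra.
Qed.

Lemma at_left_intro (b : R) (P : R -> Prop) (d : R) :
  0 < d -> (forall x, b - d < x < b -> P x) -> at_left b P.
Proof.
intros Hd H; exists (mkposreal d Hd); intros y Hy Hy0; apply H; split; [ | easy].
apply Rabs_lt_between in Hy; unfold minus, plus, opp in Hy; simpl in Hy; lra.
Qed.

Lemma lim_0_of_order (f : R -> R) (l K : R) (n : nat) :
  (forall x, 0 < x < 1 -> Rabs (f x - l * x ^ n) <= K * x ^ S n) ->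
  filterlim (fun x => f x / x ^ n) (at_right 0) (locally l).
Proof.
intros H; apply filterlim_locally; intros eps.
(* [K] may have any sign or vanish; [Rabs K + 1] is a safe divisor for the choice of the radius. *)
assert (HK : 0 < Rabs K + 1) by (pose proof (Rabs_pos K); lra).
apply at_right_0_intro with (Rmin 1 (eps / (Rabs K + 1))).
{ apply Rmin_pos; [lra | apply Rdiv_lt_0_compat; [apply cond_pos | easy]]. }
intros x [Hx0 Hx].
assert (Hx1 : x < 1) by (apply Rlt_le_trans with (1 := Hx), Rmin_l).
assert (Hx2 : x < eps / (Rabs K + 1)) by (apply Rlt_le_trans with (1 := Hx), Rmin_r).
specialize (H x (conj Hx0 Hx1)).
assert (Hn : 0 < x ^ n) by now apply pow_lt.
change (Rabs (f x / x ^ n - l) < eps).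
replace (f x / x ^ n - l) with ((f x - l * x ^ n) / x ^ n) by (field; lra).
rewrite Rabs_div, (Rabs_right (x ^ n)) by lra.
apply Rle_lt_trans with (K * x).
- apply Rmult_le_reg_r with (x ^ n); [easy | ].
  replace (_ / x ^ n * x ^ n) with (Rabs (f x - l * x ^ n)) by (field; lra).
  rewrite <- tech_pow_Rmult in H; lra.
- apply Rle_lt_trans with (Rabs K * x).
  + apply Rmult_le_compat_r; [lra | apply Rle_abs].
  + apply (Rmult_lt_compat_r (Rabs K + 1)) in Hx2; [ | easy].
    replace (eps / (Rabs K + 1) * (Rabs K + 1)) with (pos eps) in Hx2 by (field; lra).
    lra.
Qed.

Lemma lim_sinc_0 : filterlim (fun x => sin x / x) (at_right 0) (locally 1).
Proof.
apply (filterlim_ext (fun x => sin x / x ^ 1)); [intros x; now rewrite pow_1 | ].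
apply lim_0_of_order with 1; intros x Hx.
pose proof (sin_approx_bounds 0 x ltac:(lra)) as [H1 H2].
expand_approx H1; expand_approx H2.
apply Rabs_le; nra.
Qed.

Lemma lim_cos_0 : filterlim cos (at_right 0) (locally 1).
Proof.
rewrite <- cos_0.
apply filterlim_filter_le_1 with (2 := continuous_cos 0).
apply filter_le_within.
Qed.

Lemma lim_Afun_0 : filterlim (fun x => Afun x / x ^ 3) (at_right 0) (locally (1 / 3)).
Proof.
apply lim_0_of_order with 1; intros x Hx; unfold Afun.
pose proof (sin_approx_bounds 1 x ltac:(lra)) as [_ H2].
pose proof (sin_approx_bounds 0 x ltac:(lra)) as [H1 _].
pose proof (cos_approx_bounds 1 x ltac:(lra)) as [_ H4].
pose proof (cos_approx_bounds 0 x ltac:(lra)) as [H3 _].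
expand_approx H1; expand_approx H2; expand_approx H3; expand_approx H4.
apply (Rmult_le_compat_l x) in H3, H4; [ | lra | lra].
assert (0 <= x ^ 5 <= x ^ 4).
{ split; [apply pow_le; lra | ].
  replace (x ^ 5) with (x * x ^ 4) by ring.
  rewrite <- (Rmult_1_l (x ^ 4)) at 2; apply Rmult_le_compat_r; [apply pow_le | ]; lra. }
apply Rabs_le; lra.
Qed.

Lemma Nfun_multiples (x : R) : 2 * Nfun x =
  x ^ 2 * (3 + cos (2 * x)) - (1 - cos (2 * x)) - x * sin (2 * x).
Proof.
rewrite cos_2a, sin_2a; unfold Nfun.
ring_simplify; rewrite !sin_sqr; ring.
Qed.

Lemma lim_Nfun_0 : filterlim (fun x => Nfun x / x ^ 6) (at_right 0) (locally (7 / 45)).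
Proof.
apply lim_0_of_order with 1; intros x Hx.
pose proof (cos_approx_bounds 1 (2 * x) ltac:(lra)) as [H1 H2].
(* The bare cos (2x) needs an upper bound correct through x^6; where x^2 multiplies it, degree 4
   suffices. *)
pose proof (cos_approx_bounds 2 (2 * x) ltac:(lra)) as [_ H3].
pose proof (sin_approx_bounds 1 (2 * x) ltac:(lra)) as [H4 H5].
pose proof (Nfun_multiples x) as HN.
expand_approx H1; expand_approx H2; expand_approx H3; expand_approx H4; expand_approx H5.
assert (Hx2 : 0 <= x ^ 2) by apply pow2_ge_0.
pose proof (Rmult_le_compat_l _ _ _ Hx2 H1) as H1'.
pose proof (Rmult_le_compat_l _ _ _ Hx2 H2) as H2'.
apply (Rmult_le_compat_l x) in H4, H5; [ | lra | lra].
assert (0 <= x ^ 8 <= x ^ 7).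
{ split; [apply pow_le; lra | ].
  replace (x ^ 8) with (x * x ^ 7) by ring.
  rewrite <- (Rmult_1_l (x ^ 7)) at 2; apply Rmult_le_compat_r; [apply pow_le | ]; lra. }
apply Rabs_le; lra.
Qed.

Lemma lim_mult {F : (R -> Prop) -> Prop} {FF : Filter F}
  (f g : R -> R) (a b : R) :
  filterlim f F (locally a) -> filterlim g F (locally b) ->
  filterlim (fun x => f x * g x) F (locally (a * b)).
Proof. intros Hf Hg; exact (filterlim_comp_2 f g Rmult Hf Hg (filterlim_mult a b)). Qed.

Lemma lim_plus {F : (R -> Prop) -> Prop} {FF : Filter F}
  (f g : R -> R) (a b : R) :
  filterlim f F (locally a) -> filterlim g F (locally b) ->
  filterlim (fun x => f x + g x) F (locally (a + b)).
Proof. intros Hf Hg; exact (filterlim_comp_2 f g Rplus Hf Hg (filterlim_plus a b)). Qed.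

(** Continuity is requested as [ex_derive], which [auto_derive] can discharge. *)
Lemma lim_continuous {F : (R -> Prop) -> Prop} {FF : Filter F}
  (phi f : R -> R) (a : R) :
  ex_derive phi a -> filterlim f F (locally a) ->
  filterlim (fun x => phi (f x)) F (locally (phi a)).
Proof.
intros Hphi Hf; eapply filterlim_comp; [exact Hf | ].
exact (ex_derive_continuous phi a Hphi).
Qed.

Lemma lim_at_right_ext (f g : R -> R) (l : R) :
  (forall x, 0 < x < PI / 2 -> f x = g x) ->
  filterlim f (at_right 0) (locally l) -> filterlim g (at_right 0) (locally l).
Proof.
intros H; apply filterlim_ext_loc.
pose proof PI_RGT_0; now apply at_right_0_intro with (PI / 2); [lra | ].
Qed.

Lemma lim_Ufun_0 : filterlim Ufun (at_right 0) (locally 3).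
Proof.
apply lim_at_right_ext with
  (fun x => (sin x / x) ^ 2 * / (cos x * (Afun x / x ^ 3))).
{ intros x Hx; pose proof (Afun_pos x Hx); destruct (sin_cos_pos x Hx).
  unfold Ufun; field; lra. }
replace 3 with (1 ^ 2 * / (1 * (1 / 3))) by field.
apply lim_mult.
- apply (lim_continuous (fun y => y ^ 2)); [auto_derive; easy | exact lim_sinc_0].
- apply (lim_continuous Rinv); [auto_derive; lra | ].
  exact (lim_mult _ _ _ _ lim_cos_0 lim_Afun_0).
Qed.

Lemma lim_Wfun_0 : filterlim Wfun (at_right 0) (locally (7 / 5)).
Proof.
apply lim_at_right_ext with (fun x => Nfun x / x ^ 6 * / (Afun x / x ^ 3) ^ 2).
{ intros x Hx; pose proof (Afun_pos x Hx); unfold Wfun; field; lra. }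
replace (7 / 5) with (7 / 45 * / (1 / 3) ^ 2) by field.
apply lim_mult; [exact lim_Nfun_0 | ].
apply (lim_continuous (fun y => / y ^ 2)); [auto_derive; lra | exact lim_Afun_0].
Qed.

Lemma lim_hfun_0 (p q : R) :
  filterlim (hfun p q) (at_right 0) (locally (3 * q - 8 / 5 - p)).
Proof.
replace (3 * q - 8 / 5 - p) with ((q - 1) * 3 + 7 / 5 + - p) by field.
apply lim_plus; [ | apply filterlim_const].
apply lim_plus; [ | exact lim_Wfun_0].
apply lim_mult; [apply filterlim_const | exact lim_Ufun_0].
Qed.

(** The logarithm of the ratio of the two terms (sin x/x)^(p-1) A/x^2 and cos^(q-1) x sin x/3 whose
    difference is D'. It is arranged so that every logarithm has an argument tending to 1 at 0. *)
Definition Lfun (p q x : R) : R :=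
  (p - 2) * ln (sin x / x) + ln (3 * (Afun x / x ^ 3)) + (1 - q) * ln (cos x).

Lemma lim_Lfun_0 (p q : R) : filterlim (Lfun p q) (at_right 0) (locally 0).
Proof.
assert (Hln : forall f, filterlim f (at_right 0) (locally 1) ->
  filterlim (fun x => ln (f x)) (at_right 0) (locally 0)).
{ intros f Hf.
  assert (Hd : ex_derive ln 1) by (auto_derive; lra).
  pose proof (lim_continuous ln f 1 Hd Hf) as H; rewrite ln_1 in H; exact H. }
replace 0 with ((p - 2) * 0 + 0 + (1 - q) * 0) at 2 by ring.
apply lim_plus; [apply lim_plus | ].
- apply lim_mult; [apply filterlim_const | apply Hln, lim_sinc_0].
- apply Hln; replace 1 with (3 * (1 / 3)) by field.
  apply lim_mult; [apply filterlim_const | exact lim_Afun_0].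
- apply lim_mult; [apply filterlim_const | apply Hln, lim_cos_0].
Qed.

Lemma is_derive_Lfun (p q x : R) : 0 < x < PI / 2 ->
  is_derive (Lfun p q) x (Afun x / (x * sin x) * hfun p q x).
Proof.
intros Hx; pose proof (Afun_pos x Hx) as HA; destruct (sin_cos_pos x Hx) as [Hs Hc].
assert (HA3 : 0 < Afun x / x ^ 3) by (apply Rdiv_lt_0_compat; [ | apply pow_lt]; lra).
assert (Hsx : 0 < sin x / x) by (apply Rdiv_lt_0_compat; lra).
unfold Lfun, hfun, Ufun, Wfun, Nfun.
auto_derive.
- repeat split; try lra.
  + exists (x * sin x); apply is_derive_Afun.
  + change (x * (x * (x * 1))) with (x ^ 3); apply pow_nonzero; lra.
  + unfold Rdiv in HA3; simpl in HA3; lra.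
- replace (Derive (fun x => Afun x) x) with (x * sin x)
    by (symmetry; apply is_derive_unique, is_derive_Afun).
  unfold Afun in *.
  field; lra.
Qed.

(** * The transform P_p, the means and the exponent p(q) *)

Definition Pmean (p y : R) : R :=
  if Req_EM_T p 0 then - ln y else (1 - Rpower y p) / p.

Lemma Pmean_1 (p : R) : Pmean p 1 = 0.
Proof.
unfold Pmean; destruct (Req_EM_T p 0).
- rewrite ln_1; ring.
- unfold Rpower; rewrite ln_1, Rmult_0_r, exp_0; field; easy.
Qed.

(** One formula for all p, the logarithmic case included, so that later derivative arguments need no
    case distinction. *)
Lemma is_derive_Pmean (p y : R) : 0 < y ->
  is_derive (Pmean p) y (- Rpower y (p - 1)).
Proof.
intros Hy; unfold Pmean; destruct (Req_EM_T p 0) as [-> | Hp].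
- auto_derive; [easy | ].
  replace (0 - 1) with (- (1)) by ring.
  rewrite Rpower_Ropp, Rpower_1 by easy; field; lra.
- unfold Rpower; auto_derive; [easy | ].
  replace ((p - 1) * ln y) with (p * ln y + - ln y) by ring.
  rewrite exp_plus, exp_Ropp, exp_ln by easy; field; lra.
Qed.

Lemma Pmean_decreasing (p y z : R) : 0 < y -> y < z -> Pmean p z < Pmean p y.
Proof.
intros Hy Hyz; apply Ropp_lt_cancel.
apply (increasing_on_closed (fun t => - Pmean p t) _ y z Hyz
  (fun t Ht => is_derive_opp _ _ _ (is_derive_Pmean p t ltac:(lra)))).
intros t _; change (0 < - - Rpower t (p - 1)).
rewrite Ropp_involutive; apply exp_pos.
Qed.

Lemma Pmean_lt_iff (p y z : R) : 0 < y -> 0 < z -> Pmean p z < Pmean p y <-> y < z.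
Proof.
intros Hy Hz; split; [ | now apply Pmean_decreasing].
intros H; apply Rnot_le_lt; intros [Hzy | ->]; [ | lra].
pose proof (Pmean_decreasing p z y Hz Hzy); lra.
Qed.

(** On (0, 1) the difference P_p' - P_p has derivative t^(p-1) - t^(p'-1) > 0, and it vanishes at
    1. *)
Lemma Pmean_decreasing_exponent (p p' y : R) :
  0 < y < 1 -> p < p' -> Pmean p' y < Pmean p y.
Proof.
intros Hy Hp.
assert (H : Pmean p' y - Pmean p y < Pmean p' 1 - Pmean p 1).
{ apply (increasing_on_closed (fun t => Pmean p' t - Pmean p t) _ y 1 (proj2 Hy)
    (fun t Ht => is_derive_minus _ _ _ _ _ (is_derive_Pmean p' t ltac:(lra))
                   (is_derive_Pmean p t ltac:(lra)))).
  intros t Ht.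
  change (0 < - Rpower t (p' - 1) - - Rpower t (p - 1)).
  apply Rlt_0_minus, Ropp_lt_contravar; unfold Rpower; apply exp_increasing.
  assert (ln t < 0) by (rewrite <- ln_1; apply ln_increasing; lra).
  nra. }
rewrite !Pmean_1 in H; lra.
Qed.

Lemma Pmean_decreasing_exponent_le (p p' y : R) : 0 < y < 1 ->
  Pmean p' y <= Pmean p y <-> p <= p'.
Proof.
intros Hy; split.
- intros H; apply Rnot_lt_le; intros Hp.
  pose proof (Pmean_decreasing_exponent p' p y Hy Hp); lra.
- intros [Hp | ->]; [ | lra].
  now apply Rlt_le, Pmean_decreasing_exponent.
Qed.

Lemma Rpower_gt_0 (a b : R) : 0 < Rpower a b.
Proof. apply exp_pos. Qed.

(** Admissibility makes the base 1 - p P_q(t)/3 positive, so that the power can be inverted. For p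
    <= 0 this follows from P_q(t) > 0, and for 0 < p <= 3q from P_q(t) < 1/q. When q = 0 and p is
    nonzero, admissibility forces p < 0. *)
Lemma Mpq_spec (p q t : R) : admissible p q -> 0 < t < 1 ->
  0 < Mpq p q t /\ Pmean p (Mpq p q t) = Pmean q t / 3.
Proof.
intros Hpq Ht; unfold Mpq, Pmean.
assert (Hln : ln t < 0) by (rewrite <- ln_1; apply ln_increasing; lra).
destruct (Req_EM_T p 0) as [-> | Hp]; destruct (Req_EM_T q 0) as [-> | Hq].
- split; [apply Rpower_gt_0 | unfold Rpower; rewrite ln_exp; field].
- split; [apply exp_pos | rewrite ln_exp; field; easy].
- split; [apply Rpower_gt_0 | ].
  assert (0 < 1 + p / 3 * ln t).
  { destruct Hpq as [Hpq | Hpq]; [ | lra].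
    assert (0 < p / 3 * ln t) by nra; lra. }
  rewrite Rpower_mult; replace (1 / p * p) with 1 by (field; easy).
  rewrite Rpower_1 by easy; field; easy.
- split; [apply Rpower_gt_0 | ].
  assert (0 < 1 - p / (3 * q) + p / (3 * q) * Rpower t q).
  { pose proof (Rpower_gt_0 t q) as Ht0.
    replace (1 - p / (3 * q) + p / (3 * q) * Rpower t q)
      with (1 - p * ((1 - Rpower t q) / q) / 3) by (field; easy).
    assert (Hd : 0 < (1 - Rpower t q) / q /\ (0 < q -> (1 - Rpower t q) / q < 1 / q)).
    { destruct (Rtotal_order q 0) as [Hq' | [Hq' | Hq']]; [ | lra | ].
      - split; [ | lra].
        assert (1 < Rpower t q).
        { rewrite <- exp_0; unfold Rpower; apply exp_increasing; nra. }
        replace ((1 - Rpower t q) / q) with ((Rpower t q - 1) / - q) by (field; lra).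
        apply Rdiv_lt_0_compat; lra.
      - assert (Rpower t q < 1).
        { rewrite <- exp_0; unfold Rpower; apply exp_increasing; nra. }
        split; [apply Rdiv_lt_0_compat; lra | intros _].
        apply Rmult_lt_compat_r; [now apply Rinv_0_lt_compat | lra]. }
    destruct Hd as [Hd1 Hd2].
    destruct Hpq as [Hpq | [Hp0 Hpq]]; [nra | ].
    specialize (Hd2 ltac:(lra)).
    apply (Rmult_lt_compat_l p) in Hd2; [ | easy].
    assert (p * (1 / q) <= 3); [ | lra].
    apply Rmult_le_reg_r with q; [lra | ].
    replace (p * (1 / q) * q) with p by (field; easy); lra. }
  rewrite Rpower_mult; replace (1 / p * p) with 1 by (field; easy).
  rewrite Rpower_1 by easy; field; easy.
Qed.

Lemma two_div_PI_bounds : 0 < 2 / PI < 1.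
Proof.
pose proof PI_RGT_0; pose proof PI2_3_2; split; [apply Rdiv_lt_0_compat; lra | ].
apply Rmult_lt_reg_r with PI; [easy | ].
replace (2 / PI * PI) with 2 by (field; lra); lra.
Qed.

(** q(p) is 1/(3 P_p(2/pi)), so q(p) = q says exactly that the limit of D at pi/2 is 0. *)
Lemma qfun_Pmean (p q : R) : 0 < q -> qfun p = q -> Pmean p (2 / PI) = 1 / (3 * q).
Proof.
intros Hq <-; unfold qfun, Pmean in *; pose proof PI_RGT_0; pose proof PI2_3_2.
assert (Hln : ln (PI / 2) = - ln (2 / PI)).
{ rewrite <- ln_Rinv by (apply Rdiv_lt_0_compat; lra); f_equal; field; lra. }
assert (Hl : ln (2 / PI) < 0).
{ pose proof two_div_PI_bounds; rewrite <- ln_1; apply ln_increasing; lra. }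
destruct (Req_EM_T p 0) as [-> | Hp].
- rewrite Hln; field; lra.
- assert (Hr : Rpower (2 / PI) p <> 1).
  { rewrite <- exp_0; unfold Rpower; intros He; apply exp_inv in He; nra. }
  field; split; [intros He; apply Hr; lra | easy].
Qed.

(** * Propagation of signs from derivatives to functions vanishing at 0+ *)

Lemma pos_of_derive_pos (f df : R -> R) (b : R) : 0 < b ->
  (forall x, 0 < x <= b -> is_derive f x (df x)) ->
  filterlim f (at_right 0) (locally 0) ->
  (forall x, 0 < x < b -> 0 < df x) -> 0 < f b.
Proof.
intros Hb Hd H0 Hp.
assert (Hinc : forall y z, 0 < y -> y < z -> z <= b -> f y < f z).
{ intros y z Hy Hyz Hz; apply increasing_on_closed with df; [easy | | ].
  - intros x Hx; apply Hd; lra.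
  - intros x Hx; apply Hp; lra. }
(* The limit at 0 yields only 0 <= f (b/2); strictness comes from the second half of the
   interval. *)
apply Rle_lt_trans with (f (b / 2)); [ | apply Hinc; lra].
apply (filterlim_le (F := at_right 0) f (fun _ => f (b / 2)) 0 (f (b / 2))).
- apply at_right_0_intro with (b / 2); [lra | ].
  intros x Hx; apply Rlt_le, Hinc; lra.
- exact H0.
- apply filterlim_const.
Qed.

(** Otherwise [pos_of_derive_pos] applied to -f would give f b < 0. *)
Lemma derive_nonneg_of_nonneg (f df : R -> R) (b : R) : 0 < b ->
  (forall x, 0 < x <= b -> is_derive f x (df x)) ->
  filterlim f (at_right 0) (locally 0) ->
  0 <= f b -> exists x, 0 < x < b /\ 0 <= df x.
Proof.
intros Hb Hd H0 Hfb; apply NNPP; intros Hn.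
assert (H : 0 < - f b); [ | lra].
apply (pos_of_derive_pos (fun x => - f x) (fun x => - df x)); [easy | | | ].
- intros x Hx; exact (is_derive_opp _ _ _ (Hd x Hx)).
- rewrite <- Ropp_0 at 2.
  apply (lim_continuous Ropp); [auto_derive; easy | exact H0].
- intros x Hx; apply Rnot_le_lt; intros Hdx; apply Hn; exists x; split; lra.
Qed.

(** The relation D' = g (e^L - 1) is kept only through two sign implications, because these also
    hold for -D and -L, whereas the formula changes under negation. One pair of lemmas then serves
    increasing and decreasing h. *)
Definition sign_chain (D d L k h : R -> R) (b : R) : Prop :=
  filterlim D (at_right 0) (locally 0) /\
  filterlim L (at_right 0) (locally 0) /\
  forall x, 0 < x < b ->
    is_derive D x (d x) /\ is_derive L x (k x * h x) /\ 0 < k x /\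
    (0 < L x -> 0 < d x) /\ (0 <= d x -> 0 <= L x).

(** Positivity climbs from h to L and from L to D. The separate endpoint c allows h > 0 to be known
    only near 0. *)
Lemma sign_chain_pos (D d L k h : R -> R) (b c : R) :
  sign_chain D d L k h b -> c <= b ->
  (forall x, 0 < x < c -> 0 < h x) -> forall x, 0 < x < c -> 0 < D x.
Proof.
intros [HD [HL H]] Hcb Hh x Hx.
apply pos_of_derive_pos with (df := d); [easy | | easy | ].
- intros y Hy; apply H; lra.
- intros y Hy; apply H; [lra | ].
  apply pos_of_derive_pos with (df := fun z => k z * h z); [easy | | easy | ].
  + intros z Hz; apply H; lra.
  + intros z Hz; apply Rmult_lt_0_compat; [apply H | apply Hh]; lra.
Qed.

(* Were [D x0 >= 0], then [L >= 0] and [h >= 0] at earlier points, so that [h], [L] and [D']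
   are positive from there on and [D] could not descend to [l <= 0]. *)
Lemma sign_chain_neg (D d L k h : R -> R) (b l : R) :
  sign_chain D d L k h b ->
  (forall x y, 0 < x -> x < y -> y < b -> h x < h y) ->
  filterlim D (at_left b) (locally l) -> l <= 0 ->
  forall x, 0 < x < b -> D x < 0.
Proof.
intros [HD [HL H]] Hh Hl Hl0 x0 Hx0; apply Rnot_le_lt; intros Hn.
destruct (derive_nonneg_of_nonneg D d x0) as [x1 [Hx1 Hd1]]; [easy | | easy | easy | ].
{ intros x Hx; apply H; lra. }
assert (HL1 : 0 <= L x1) by (apply H; lra).
destruct (derive_nonneg_of_nonneg L (fun x => k x * h x) x1) as [x2 [Hx2 Hd2]];
  [easy | | easy | easy | ].
{ intros x Hx; apply H; lra. }
assert (Hk2 : 0 < k x2) by (apply H; lra).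
assert (Hh2 : 0 <= h x2) by nra.
assert (HLpos : forall y, x1 < y < b -> 0 < L y).
{ intros y Hy; apply Rle_lt_trans with (1 := HL1).
  apply increasing_on_closed with (df := fun x => k x * h x); [easy | | ].
  - intros x Hx; apply H; lra.
  - intros x Hx; apply Rmult_lt_0_compat; [apply H; lra | ].
    apply Rle_lt_trans with (1 := Hh2); apply Hh; lra. }
assert (HDinc : forall y z, x1 < y -> y < z -> z < b -> D y < D z).
{ intros y z Hy Hyz Hz; apply increasing_on_closed with (df := d); [easy | | ].
  - intros x Hx; apply H; lra.
  - intros x Hx; apply H; [lra | apply HLpos; lra]. }
(* [D x0] may be 0; a later point gives 0 < D x3 <= l, against l <= 0. *)
set (x3 := (x0 + b) / 2).
assert (H3 : D x0 < D x3) by (apply HDinc; unfold x3; lra).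
assert (D x3 <= l); [ | lra].
apply (filterlim_le (F := at_left b) (fun _ => D x3) D (D x3) l).
- apply at_left_intro with (b - x3); [unfold x3; lra | ].
  intros y Hy; apply Rlt_le, HDinc; unfold x3 in *; lra.
- apply filterlim_const.
- exact Hl.
Qed.

(** * The function D: derivative, limits at 0 and pi/2, and its sign in terms of the means *)

Definition Dfun (p q x : R) : R := Pmean p (sin x / x) - Pmean q (cos x) / 3.

Definition dfun (p q x : R) : R :=
  Rpower (cos x) (q - 1) * sin x / 3 * (exp (Lfun p q x) - 1).

Lemma is_derive_Dfun (p q x : R) : 0 < x < PI / 2 ->
  is_derive (Dfun p q) x (dfun p q x).
Proof.
intros Hx; pose proof (Afun_pos x Hx) as HA; destruct (sin_cos_pos x Hx) as [Hs Hc].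
assert (HA3 : 0 < Afun x / x ^ 3) by (apply Rdiv_lt_0_compat; [ | apply pow_lt]; lra).
assert (Hsx : 0 < sin x / x) by (apply Rdiv_lt_0_compat; lra).
assert (Hd : is_derive (fun t => sin t / t) x (- Afun x / x ^ 2)).
{ auto_derive; [lra | unfold Afun; field; lra]. }
pose proof (is_derive_comp (Pmean p) (fun t => sin t / t) x _ _
  (is_derive_Pmean p _ Hsx) Hd) as H1.
pose proof (is_derive_comp (Pmean q) cos x _ _
  (is_derive_Pmean q _ Hc) (is_derive_cos x)) as H2.
pose proof (is_derive_minus _ _ _ _ _ H1 (is_derive_scal _ _ (/ 3) _ H2)) as H.
unfold Dfun; eapply is_derive_ext; [ | evar_last; [exact H | ]].
- intros t; unfold minus, plus, opp; simpl; unfold Rdiv; ring.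
- unfold dfun, Lfun; rewrite !exp_plus, exp_ln by lra.
  fold (Rpower (sin x / x) (p - 2)); fold (Rpower (cos x) (1 - q)).
  (* This splits off from (sin x/x)^(p-1) the power (sin x/x)^(p-2) that occurs in e^L. *)
  replace (p - 1) with (p - 2 + 1) by ring.
  rewrite Rpower_plus, (Rpower_1 (sin x / x)) by easy.
  replace (1 - q) with (- (q - 1)) by ring; rewrite Rpower_Ropp.
  pose proof (Rpower_gt_0 (cos x) (q - 1)).
  unfold minus, plus, opp, scal; simpl; unfold mult; simpl.
  field; lra.
Qed.

Lemma lim_Dfun_0 (p q : R) : filterlim (Dfun p q) (at_right 0) (locally 0).
Proof.
assert (HP : forall r f, filterlim f (at_right 0) (locally 1) ->
  filterlim (fun x => Pmean r (f x)) (at_right 0) (locally 0)).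
{ intros r f Hf.
  assert (Hd : ex_derive (Pmean r) 1) by (eexists; apply is_derive_Pmean; lra).
  pose proof (lim_continuous _ f 1 Hd Hf) as H; rewrite Pmean_1 in H; exact H. }
pose proof (lim_plus _ _ _ _ (HP p _ lim_sinc_0)
  (lim_mult _ _ _ _ (HP q _ lim_cos_0) (filterlim_const (- / 3)))) as H.
rewrite Rmult_0_l, Rplus_0_l in H.
eapply filterlim_ext; [ | exact H].
intros x; unfold Dfun; simpl; field.
Qed.

Lemma sign_chain_Dfun (p q : R) :
  sign_chain (Dfun p q) (dfun p q) (Lfun p q)
    (fun x => Afun x / (x * sin x)) (hfun p q) (PI / 2).
Proof.
split; [apply lim_Dfun_0 | split; [apply lim_Lfun_0 | ]].
intros x Hx; pose proof (Afun_pos x Hx) as HA; destruct (sin_cos_pos x Hx) as [Hs Hc].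
assert (Hg : 0 < Rpower (cos x) (q - 1) * sin x / 3).
{ pose proof (Rpower_gt_0 (cos x) (q - 1)); nra. }
split; [ | split; [ | split; [ | split]]].
- now apply is_derive_Dfun.
- now apply is_derive_Lfun.
- apply Rdiv_lt_0_compat; nra.
- intros HL; apply Rmult_lt_0_compat; [easy | ].
  apply exp_increasing in HL; rewrite exp_0 in HL; lra.
- intros Hd; apply Rnot_lt_le; intros HL.
  apply exp_increasing in HL; rewrite exp_0 in HL.
  unfold dfun in Hd; nra.
Qed.

Lemma sign_chain_opp_Dfun (p q : R) :
  sign_chain (fun x => - Dfun p q x) (fun x => - dfun p q x) (fun x => - Lfun p q x)
    (fun x => Afun x / (x * sin x)) (fun x => - hfun p q x) (PI / 2).
Proof.
assert (Hopp : forall f, filterlim f (at_right 0) (locally 0) ->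
  filterlim (fun x => - f x) (at_right 0) (locally 0)).
{ intros f Hf; rewrite <- Ropp_0 at 2.
  apply (lim_continuous Ropp); [auto_derive; easy | exact Hf]. }
split; [apply Hopp, lim_Dfun_0 | split; [apply Hopp, lim_Lfun_0 | ]].
intros x Hx; pose proof (Afun_pos x Hx) as HA; destruct (sin_cos_pos x Hx) as [Hs Hc].
assert (Hg : 0 < Rpower (cos x) (q - 1) * sin x / 3).
{ pose proof (Rpower_gt_0 (cos x) (q - 1)); nra. }
split; [ | split; [ | split; [ | split]]].
- now apply (is_derive_opp (Dfun p q)), is_derive_Dfun.
- evar_last; [apply (is_derive_opp (Lfun p q)), is_derive_Lfun; easy | ].
  unfold opp; simpl; ring.
- apply Rdiv_lt_0_compat; nra.
- intros HL; assert (HL' : Lfun p q x < 0) by lra.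
  apply exp_increasing in HL'; rewrite exp_0 in HL'.
  unfold dfun; nra.
- intros Hd; apply Rnot_lt_le; intros HL; assert (HL' : 0 < Lfun p q x) by lra.
  apply exp_increasing in HL'; rewrite exp_0 in HL'.
  unfold dfun in Hd; nra.
Qed.

(** Continuity at pi/2 is no help: [ln 0] is 0 by default, so [Rpower 0 q] is 1. Instead, 0 < cos x
    < eps^(1/q) gives cos^q x < eps. *)
Lemma lim_Rpower_cos_PI2 (q : R) : 0 < q ->
  filterlim (fun x => Rpower (cos x) q) (at_left (PI / 2)) (locally 0).
Proof.
intros Hq; pose proof PI_RGT_0.
apply filterlim_locally; intros eps.
assert (Hcos : filterlim cos (at_left (PI / 2)) (locally 0)).
{ rewrite <- cos_PI2.
  apply filterlim_filter_le_1 with (2 := continuous_cos (PI / 2)).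
  apply filter_le_within. }
assert (H1 := proj1 (filterlim_locally _ _) Hcos (mkposreal _ (Rpower_gt_0 eps (/ q)))).
assert (H2 : at_left (PI / 2) (fun x => 0 < x < PI / 2)).
{ apply at_left_intro with (PI / 2); [lra | intros x Hx; lra]. }
generalize (filter_and _ _ H1 H2); apply filter_imp; intros x [Hb Hx].
destruct (sin_cos_pos x Hx) as [_ Hc].
change (Rabs (cos x - 0) < Rpower eps (/ q)) in Hb.
change (Rabs (Rpower (cos x) q - 0) < eps).
rewrite Rminus_0_r, Rabs_right in Hb by lra.
rewrite Rminus_0_r, Rabs_right by apply Rgt_ge, Rpower_gt_0.
rewrite <- (Rpower_1 eps) by apply cond_pos.
replace 1 with (/ q * q) by (field; lra).
rewrite <- Rpower_mult; apply Rlt_Rpower_l; [easy | split; easy].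
Qed.

Lemma lim_Dfun_PI2 (p q : R) : 0 < q ->
  filterlim (Dfun p q) (at_left (PI / 2)) (locally (Pmean p (2 / PI) - 1 / (3 * q))).
Proof.
intros Hq; pose proof PI_RGT_0.
assert (Hs : filterlim (fun x => sin x / x) (at_left (PI / 2)) (locally (2 / PI))).
{ replace (2 / PI) with (sin (PI / 2) / (PI / 2)) by (rewrite sin_PI2; field; lra).
  apply (lim_continuous (fun x => sin x / x)); [auto_derive; lra | ].
  apply filterlim_filter_le_1 with (2 := filterlim_id _ _).
  apply filter_le_within. }
assert (Hd : ex_derive (Pmean p) (2 / PI)).
{ eexists; apply is_derive_Pmean, Rdiv_lt_0_compat; lra. }
pose proof (lim_plus _ _ _ _ (lim_continuous _ _ _ Hd Hs)
  (lim_plus _ _ _ _ (filterlim_const (- (1 / (3 * q))))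
    (lim_mult _ _ _ _ (lim_Rpower_cos_PI2 q Hq) (filterlim_const (1 / (3 * q)))))) as HD.
rewrite Rmult_0_l, Rplus_0_r in HD.
eapply filterlim_ext; [ | exact HD].
(* The third occurrence is P_q(cos x); P_p(sin x/x) stays folded on both sides. *)
intros x; unfold Dfun, Pmean at 3; simpl.
destruct (Req_EM_T q 0); [lra | field; lra].
Qed.

(** P_p reverses order and sends the mean to P_q(cos x)/3. *)
Lemma Mpq_lt_sinc_iff (p q x : R) : admissible p q -> 0 < x < PI / 2 ->
  Mpq p q (cos x) < sin x / x <-> Dfun p q x < 0.
Proof.
intros Hpq Hx; destruct (sin_cos_pos x Hx) as [Hs Hc].
assert (Hc1 : cos x < 1).
{ rewrite <- cos_0; apply cos_decreasing_1; lra. }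
destruct (Mpq_spec p q (cos x) Hpq (conj Hc Hc1)) as [HM HP].
rewrite <- (Pmean_lt_iff p) by (try easy; apply Rdiv_lt_0_compat; lra).
rewrite HP; unfold Dfun; lra.
Qed.

Lemma sinc_lt_Mpq_iff (p q x : R) : admissible p q -> 0 < x < PI / 2 ->
  sin x / x < Mpq p q (cos x) <-> 0 < Dfun p q x.
Proof.
intros Hpq Hx; destruct (sin_cos_pos x Hx) as [Hs Hc].
assert (Hc1 : cos x < 1).
{ rewrite <- cos_0; apply cos_decreasing_1; lra. }
destruct (Mpq_spec p q (cos x) Hpq (conj Hc Hc1)) as [HM HP].
rewrite <- (Pmean_lt_iff p) by (try easy; apply Rdiv_lt_0_compat; lra).
rewrite HP; unfold Dfun; lra.
Qed.

(** * Sufficiency and necessity of the conditions coming from 0 and from pi/2 *)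

Lemma Dfun_pos_somewhere (p q : R) : p < 3 * q - 8 / 5 ->
  exists x, 0 < x < PI / 2 /\ 0 < Dfun p q x.
Proof.
intros Hp; pose proof PI_RGT_0.
(* The limit of h at 0 itself serves as epsilon, so h > 0 near 0. *)
assert (He : 0 < 3 * q - 8 / 5 - p) by lra.
destruct (at_right_0_elim _
  (proj1 (filterlim_locally _ _) (lim_hfun_0 p q) (mkposreal _ He))) as [d [Hd Hh]].
assert (Hm : 0 < Rmin d (PI / 2)) by (apply Rmin_pos; lra).
pose proof (Rmin_l d (PI / 2)); pose proof (Rmin_r d (PI / 2)).
exists (Rmin d (PI / 2) / 2); split; [lra | ].
apply (sign_chain_pos _ _ _ _ _ _ (Rmin d (PI / 2)) (sign_chain_Dfun p q)); [easy | | lra].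
intros x Hx; specialize (Hh x ltac:(lra)).
change (Rabs (hfun p q x - (3 * q - 8 / 5 - p)) < 3 * q - 8 / 5 - p) in Hh.
apply Rabs_lt_between in Hh; lra.
Qed.

Lemma Dfun_neg_somewhere (p q : R) : 3 * q - 8 / 5 < p ->
  exists x, 0 < x < PI / 2 /\ Dfun p q x < 0.
Proof.
intros Hp; pose proof PI_RGT_0.
assert (He : 0 < - (3 * q - 8 / 5 - p)) by lra.
destruct (at_right_0_elim _
  (proj1 (filterlim_locally _ _) (lim_hfun_0 p q) (mkposreal _ He))) as [d [Hd Hh]].
assert (Hm : 0 < Rmin d (PI / 2)) by (apply Rmin_pos; lra).
pose proof (Rmin_l d (PI / 2)); pose proof (Rmin_r d (PI / 2)).
exists (Rmin d (PI / 2) / 2); split; [lra | ].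
apply Ropp_lt_cancel; rewrite Ropp_0.
apply (sign_chain_pos _ _ _ _ _ _ (Rmin d (PI / 2)) (sign_chain_opp_Dfun p q));
  [easy | | lra].
intros x Hx; specialize (Hh x ltac:(lra)).
change (Rabs (hfun p q x - (3 * q - 8 / 5 - p)) < - (3 * q - 8 / 5 - p)) in Hh.
apply Rabs_lt_between in Hh; lra.
Qed.

Lemma Dfun_pos_of_q_ge (p q : R) : 1 <= q -> p <= 3 * q - 8 / 5 ->
  forall x, 0 < x < PI / 2 -> 0 < Dfun p q x.
Proof.
intros Hq Hp.
apply (sign_chain_pos _ _ _ _ _ _ (PI / 2) (sign_chain_Dfun p q)); [lra | ].
intros x Hx.
(* Comparison with the limit at 0 is only weak; passing through x/2 makes h x > 0 strict. *)
apply Rle_lt_trans with (hfun p q (x / 2)); [ | apply hfun_increasing; lra].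
apply Rle_trans with (3 * q - 8 / 5 - p); [lra | ].
apply (filterlim_le (F := at_right 0) (hfun p q) (fun _ => hfun p q (x / 2))
  (3 * q - 8 / 5 - p) (hfun p q (x / 2))).
- apply at_right_0_intro with (x / 2); [lra | ].
  intros y Hy; apply Rlt_le, hfun_increasing; lra.
- apply lim_hfun_0.
- apply filterlim_const.
Qed.

Lemma Dfun_neg_of_q_le (p q : R) : q <= 34 / 35 -> 3 * q - 8 / 5 <= p ->
  forall x, 0 < x < PI / 2 -> Dfun p q x < 0.
Proof.
intros Hq Hp x Hx; apply Ropp_lt_cancel; rewrite Ropp_0; revert x Hx.
apply (sign_chain_pos _ _ _ _ _ _ (PI / 2) (sign_chain_opp_Dfun p q)); [lra | ].
intros x Hx; rewrite <- Ropp_0; apply Ropp_lt_contravar.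
apply Rlt_le_trans with (hfun p q (x / 2)); [apply hfun_decreasing; lra | ].
apply Rle_trans with (3 * q - 8 / 5 - p); [ | lra].
apply (filterlim_le (F := at_right 0) (fun _ => hfun p q (x / 2)) (hfun p q)
  (hfun p q (x / 2)) (3 * q - 8 / 5 - p)).
- apply at_right_0_intro with (x / 2); [lra | ].
  intros y Hy; apply Rlt_le, hfun_decreasing; lra.
- apply filterlim_const.
- apply lim_hfun_0.
Qed.

(** With 1/(3q) = P_p0(2/pi), the limit of D at pi/2 is P_p(2/pi) - P_p0(2/pi) <= 0, as
    [sign_chain_neg] requires. *)
Lemma Dfun_neg_of_p_ge (p q p0 : R) : 1 <= q -> qfun p0 = q -> p0 <= p ->
  forall x, 0 < x < PI / 2 -> Dfun p q x < 0.
Proof.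
intros Hq Hp0 Hp.
apply sign_chain_neg with (1 := sign_chain_Dfun p q)
  (3 := lim_Dfun_PI2 p q ltac:(lra)).
- intros x y; now apply hfun_increasing.
- rewrite <- (qfun_Pmean p0 q) by lra.
  apply Rle_minus, Pmean_decreasing_exponent_le; [exact two_div_PI_bounds | easy].
Qed.

Lemma Dfun_pos_of_p_le (p q p0 : R) : 0 < q <= 34 / 35 -> qfun p0 = q -> p <= p0 ->
  forall x, 0 < x < PI / 2 -> 0 < Dfun p q x.
Proof.
intros Hq Hp0 Hp x Hx; apply Ropp_lt_cancel; rewrite Ropp_0; revert x Hx.
apply sign_chain_neg with (1 := sign_chain_opp_Dfun p q)
  (l := - (Pmean p (2 / PI) - 1 / (3 * q))).
- intros x y Hx Hxy Hy; apply Ropp_lt_contravar, hfun_decreasing; lra.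
- apply (lim_continuous Ropp); [auto_derive; easy | apply lim_Dfun_PI2; lra].
- rewrite <- (qfun_Pmean p0 q) by lra.
  pose proof (proj2 (Pmean_decreasing_exponent_le p p0 _ two_div_PI_bounds) Hp); lra.
Qed.

(** In the limit at pi/2, D < 0 becomes P_p(2/pi) <= P_p0(2/pi), which orders the exponents. *)
Lemma p_ge_of_Dfun_neg (p q p0 : R) : 0 < q -> qfun p0 = q ->
  (forall x, 0 < x < PI / 2 -> Dfun p q x < 0) -> p0 <= p.
Proof.
intros Hq Hp0 H; pose proof PI_RGT_0.
apply (Pmean_decreasing_exponent_le _ _ _ two_div_PI_bounds).
rewrite (qfun_Pmean p0 q Hq Hp0); apply Rminus_le.
apply (filterlim_le (F := at_left (PI / 2)) (Dfun p q) (fun _ => 0)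
  (Pmean p (2 / PI) - 1 / (3 * q)) 0).
- apply at_left_intro with (PI / 2); [lra | ].
  intros x Hx; apply Rlt_le, H; lra.
- now apply lim_Dfun_PI2.
- apply filterlim_const.
Qed.

Lemma p_le_of_Dfun_pos (p q p0 : R) : 0 < q -> qfun p0 = q ->
  (forall x, 0 < x < PI / 2 -> 0 < Dfun p q x) -> p <= p0.
Proof.
intros Hq Hp0 H; pose proof PI_RGT_0.
apply (Pmean_decreasing_exponent_le _ _ _ two_div_PI_bounds).
rewrite (qfun_Pmean p0 q Hq Hp0); apply Rminus_le, Ropp_le_cancel.
rewrite Ropp_0, Ropp_minus_distr.
apply (filterlim_le (F := at_left (PI / 2)) (fun _ => 0) (Dfun p q)
  0 (Pmean p (2 / PI) - 1 / (3 * q))).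
- apply at_left_intro with (PI / 2); [lra | ].
  intros x Hx; apply Rlt_le, H; lra.
- apply filterlim_const.
- now apply lim_Dfun_PI2.
Qed.

Lemma p_ge_of_Dfun_neg_near_0 (p q : R) :
  (forall x, 0 < x < PI / 2 -> Dfun p q x < 0) -> 3 * q - 8 / 5 <= p.
Proof.
intros H; apply Rnot_lt_le; intros Hp.
destruct (Dfun_pos_somewhere p q Hp) as [x [Hx HD]].
specialize (H x Hx); lra.
Qed.

Lemma p_le_of_Dfun_pos_near_0 (p q : R) :
  (forall x, 0 < x < PI / 2 -> 0 < Dfun p q x) -> p <= 3 * q - 8 / 5.
Proof.
intros H; apply Rnot_lt_le; intros Hp.
destruct (Dfun_neg_somewhere p q Hp) as [x [Hx HD]].
specialize (H x Hx); lra.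
Qed.

Theorem theorem4 (q p1 p2 : R) :
  admissible p1 q -> admissible p2 q ->
  (1 <= q -> forall p0 : R, qfun p0 = q ->
     ((forall x, 0 < x < PI / 2 ->
         Mpq p1 q (cos x) < sin x / x /\ sin x / x < Mpq p2 q (cos x))
      <-> (p0 <= p1 /\ p2 <= 3 * q - 8 / 5))) /\
  (0 < q <= 34 / 35 -> forall p0 : R, qfun p0 = q ->
     ((forall x, 0 < x < PI / 2 ->
         Mpq p1 q (cos x) < sin x / x /\ sin x / x < Mpq p2 q (cos x))
      <-> (3 * q - 8 / 5 <= p1 /\ p2 <= p0))) /\
  (q <= 0 ->
     ((forall x, 0 < x < PI / 2 -> Mpq p1 q (cos x) < sin x / x)
      <-> 3 * q - 8 / 5 <= p1)).
Proof.
intros Hp1 Hp2.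
pose proof (fun x => Mpq_lt_sinc_iff p1 q x Hp1) as H1.
pose proof (fun x => sinc_lt_Mpq_iff p2 q x Hp2) as H2.
split; [ | split].
- intros Hq p0 Hp0; split.
  + intros H; split.
    * apply (p_ge_of_Dfun_neg p1 q p0); [lra | easy | ].
      intros x Hx; now apply H1, H.
    * apply p_le_of_Dfun_pos_near_0; intros x Hx; now apply H2, H.
  + intros [Hle1 Hle2] x Hx; split.
    * apply H1; [easy | now apply (Dfun_neg_of_p_ge p1 q p0)].
    * apply H2; [easy | now apply Dfun_pos_of_q_ge].
- intros Hq p0 Hp0; split.
  + intros H; split.
    * apply p_ge_of_Dfun_neg_near_0; intros x Hx; now apply H1, H.
    * apply (p_le_of_Dfun_pos p2 q p0); [lra | easy | ].
      intros x Hx; now apply H2, H.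
  + intros [Hle1 Hle2] x Hx; split.
    * apply H1; [easy | apply Dfun_neg_of_q_le; [lra | easy | easy]].
    * apply H2; [easy | now apply (Dfun_pos_of_p_le p2 q p0)].
- intros Hq; split.
  + intros H; apply p_ge_of_Dfun_neg_near_0; intros x Hx; now apply H1, H.
  + intros Hle x Hx; apply H1; [easy | apply Dfun_neg_of_q_le; [lra | easy | easy]].
Qed.
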